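(* Let $\nu_m=\nu^{\rhd m}$ be the $m$-fold monotone convolution of the standard semicircle law $\nu$ (equivalently the vacuum distribution of $G_1+\cdots+G_m$). Then for each $m\ge1$ the support of $\nu_m$ is a symmetric interval $[-a_m,a_m]$, where $a_1=2$ and $$a_{m+1}=a_m+\frac1{a_m}\qquad(m\ge1).$$ Moreover $\mathrm{supp}(\nu_{m-1})\subseteq\mathrm{supp}(\nu_m)$ for $m\ge2$.
   Context: The standard semicircle law is $\nu(dx)=\frac1{2\pi}\sqrt{4-x^2}\mathbf 1_{[-2,2]}dx$. For probability measures $\mu,\nu$ on $\mathbb R$ with Cauchy transforms $\mathcal G_\mu(z)=\int\frac{\mu(dx)}{z-x}$ and reciprocal Cauchy transforms $H_\mu=1/\mathcal G_\mu$, the monotone convolution $\mu\rhd\nu$ is the unique probability measure $\rho$ with $H_\rho=H_\mu\circ H_\nu$ on $\mathbb C^+$; $\nu^{\rhd m}=\nu\rhd\cdots\rhd\nu$ ($m$ factors). In the paper's model, $\nu_m$ is the vacuum distribution of $G_1+\cdots+G_m$, where $G_i=A_i+A_i^\dagger$ are the position operators on the weakly monotone Fock space. *)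

(* Defs.v *)
From mathcomp Require Import all_boot all_order all_algebra.
From mathcomp Require Import all_classical all_reals all_analysis.
From mathcomp.real_closed Require Export complex.
Set Implicit Arguments.
Unset Strict Implicit.
Unset Printing Implicit Defensive.
Import Order.TTheory GRing.Theory Num.Theory.
Import numFieldNormedType.Exports.
Local Open Scope classical_set_scope.
Local Open Scope ring_scope.

Section MonotoneDefs.
Context {R : realType}.

Definition semicircle_pdf (x : R) : R :=
  if `|x| <= 2 then Num.sqrt (4 - x ^+ 2) / (2 * pi) else 0.

Definition is_semicircle (P : probability R R) : Prop :=
  forall A : set R, measurable A ->
    P A = (\int[lebesgue_measure]_(x in A) (semicircle_pdf x)%:E)%E.

Definition cauchy (P : probability R R) (z : R[i]) : R[i] :=
  Complex (\int[P]_(x in [set: R]) complex.Re ((z - x%:C)%C^-1))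
          (\int[P]_(x in [set: R]) complex.Im ((z - x%:C)%C^-1)).

Definition rcauchy (P : probability R R) (z : R[i]) : R[i] := (cauchy P z)^-1.

Definition upper_half (z : R[i]) : Prop := 0 < complex.Im z.

Definition is_monotone_conv (mu nu rho : probability R R) : Prop :=
  forall z : R[i], upper_half z -> rcauchy rho z = rcauchy mu (rcauchy nu z).

Definition msupport (P : probability R R) : set R :=
  [set x | forall e : R, 0 < e -> (0 < P (ball x e))%E].

End MonotoneDefs.

(* Main.v *)
From HB Require Import structures.
Require Import Defs.
From mathcomp Require Import all_boot all_order all_algebra.
From mathcomp Require Import all_classical all_reals all_analysis.
From mathcomp Require Import measurable_realfun ring lra.
Import Order.TTheory GRing.Theory Num.Theory.
Import numFieldNormedType.Exports.
Local Open Scope classical_set_scope.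
Local Open Scope ring_scope.

(* Write w for the solution of w + 1/w = z with |w| > 1.  The Cauchy transform
   of the semicircle law is 1/w: the functions g_n(z) = ∫ S_n(t)/(z - t) sc(dt),
   with S_n the Chebyshev polynomials of the second kind rescaled to [-2, 2],
   satisfy g_{n+2} = z g_{n+1} - g_n and g_1 = z g_0 - 1 by orthogonality, so
   that g_{n+1} - g_n/w = w^n (w g_0 - 1); the left side grows polynomially in n,
   which forces g_0 = 1/w.  Hence G_rho(w + 1/w) = G_mu(w) when
   rho = mu |> sc.

   A point x is outside the support of P exactly when the Poisson integral
   - Im G_P(x' + iy) is O(y) uniformly for x' near x.  Since Im z and Im w are
   comparable away from |w| = 1, a point u + 1/u with |u| > 1 real lies in
   supp rho iff u lies in supp mu; and for x = 2 cos(theta) the Poisson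
   integral of rho near x tends to the one of mu at exp(i theta), which is
   positive.  So supp rho is [-2, 2] together with the image of
   supp mu \ [-1, 1] under u |-> u + 1/u. *)

Section ChebyshevS.
Context {R : realType}.
Implicit Types (n : nat) (t : R).

Fixpoint chebS n : {poly R} :=
  match n with
  | 0 => 1
  | n'.+1 => match n' with 0 => 'X | m.+1 => 'X * chebS n' - chebS m end
  end.

Lemma chebSS n : chebS n.+2 = 'X * chebS n.+1 - chebS n.
Proof. by []. Qed.

Lemma chebS_deriv n : (4 - 'X ^+ 2) * (chebS n)^`() - 'X * chebS n =
  - n.+1%:R * (2 * chebS n.+1 - 'X * chebS n).
Proof.
suff [] : (4 - 'X ^+ 2) * (chebS n)^`() - 'X * chebS n =
  - n.+1%:R * (2 * chebS n.+1 - 'X * chebS n) /\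
  (4 - 'X ^+ 2) * (chebS n.+1)^`() - 'X * chebS n.+1 =
  - n.+2%:R * (2 * chebS n.+2 - 'X * chebS n.+1) by [].
elim: n => [|n [IH0 IH1]].
  by rewrite /= derivX -polyC1 derivC; split; ring.
split=> //; rewrite [in LHS]chebSS derivB derivM derivX mul1r.
rewrite (chebSS n.+1) (chebSS n).
move: IH1 IH0; rewrite (chebSS n).
move: (chebS n) (chebS n.+1) => p q IH1 IH0.
have -> : (4 - 'X ^+ 2) * (q + 'X * q^`() - p^`()) - 'X * ('X * q - p) =
  (4 - 'X ^+ 2) * q + 'X * ((4 - 'X ^+ 2) * q^`() - 'X * q)
  - ((4 - 'X ^+ 2) * p^`() - 'X * p) :> {poly R} by ring.
by rewrite IH1 IH0 -(natr1 n.+2) -(natr1 n.+1); ring.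
Qed.

Lemma chebS_invariant n t : (chebS n.+1).[t] ^+ 2 -
  t * (chebS n.+1).[t] * (chebS n).[t] + (chebS n).[t] ^+ 2 = 1.
Proof.
elim: n => [|n IH]; first by rewrite /= hornerX hornerC; ring.
rewrite chebSS hornerD hornerN hornerM hornerX -[RHS]IH; ring.
Qed.

Lemma chebS_bound n t : `|t| <= 2 -> `|(chebS n).[t]| <= n.+1%:R.
Proof.
rewrite ler_norml => /andP[t1 t2].
elim: n => [|n IH]; first by rewrite /= hornerC normr1.
have := chebS_invariant n t.
move: (chebS n.+1).[t] (chebS n).[t] IH => p q IH E.
have T1 : `|p - t / 2 * q| <= 1.
  rewrite -[leRHS]normr1 -ler_sqr ?nnegrE// !real_normK ?num_real// expr1n.
  rewrite -[leRHS]E -subr_ge0.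
  have -> : p ^+ 2 - t * p * q + q ^+ 2 - (p - t / 2 * q) ^+ 2 =
    (1 - (t / 2) ^+ 2) * q ^+ 2 by field.
  by apply: mulr_ge0; [nra | exact: sqr_ge0].
rewrite -(natr1 n.+1) -(subrK (t / 2 * q) p) addrC.
apply: (le_trans (ler_normD _ _)); apply: lerD => //.
apply: le_trans IH; rewrite normrM -[leRHS]mul1r ler_wpM2r//.
by rewrite ler_norml; lra.
Qed.

Lemma is_derive_sqrt_4B t : -2 < t < 2 ->
  is_derive t 1 (fun u => Num.sqrt (4 - u ^+ 2)) (- t / Num.sqrt (4 - t ^+ 2)).
Proof.
move=> t2; have h : 0 < 4 - t ^+ 2 by nra.
have D1 : is_derive t 1 (fun u : R => 4 - u ^+ 2) (- (2 * t)).
  have -> : (fun u : R => 4 - u ^+ 2) = cst 4 - (@id R) ^+ 2 by [].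
  apply: is_derive_eq; rewrite /= sub0r /GRing.scale/= expr1.
  by rewrite mulr1.
have D2 := @is_derive1_sqrt _ _ h.
have := @is_derive1_comp _ Num.sqrt (fun u : R => 4 - u ^+ 2) t _ _ D2 D1.
move=> /is_derive_eq; apply; rewrite /GRing.scale /=.
have : Num.sqrt (4 - t ^+ 2) != 0 by rewrite gt_eqF// sqrtr_gt0.
by move=> ?; field.
Qed.

Lemma continuous_sqrt_4B : continuous (fun u : R => Num.sqrt (4 - u ^+ 2)).
Proof.
move=> t; apply: (@continuous_comp _ _ _ (fun u : R => 4 - u ^+ 2) Num.sqrt).
  by apply: cvgB; [exact: cvg_cst | exact: exprn_continuous].
exact: sqrt_continuous.
Qed.

Lemma integral_chebS n :
  (\int[lebesgue_measure]_(t in `[(-2)%R, 2%R] : set R)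
     (Num.sqrt (4 - t ^+ 2) * (chebS n.+1).[t])%:E = 0)%E.
Proof.
have [q Lq] : exists q : {poly R},
    (4 - 'X ^+ 2) * q^`() - 'X * q = (4 - 'X ^+ 2) * chebS n.+1.
  exists (n.+3%:R^-1 *: chebS n.+2 - n.+1%:R^-1 *: chebS n).
  have D0 := chebS_deriv n; have D2 := chebS_deriv n.+2.
  rewrite derivB !derivZ.
  rewrite -!mul_polyC.
  set a := (n.+3%:R^-1)%:P; set b := (n.+1%:R^-1)%:P.
  have -> : (4 - 'X ^+ 2) * (a * (chebS n.+2)^`() - b * (chebS n)^`())
     - 'X * (a * chebS n.+2 - b * chebS n) =
     a * ((4 - 'X ^+ 2) * (chebS n.+2)^`() - 'X * chebS n.+2)
     - b * ((4 - 'X ^+ 2) * (chebS n)^`() - 'X * chebS n) by ring.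
  rewrite D0 D2 !mulrA !mulrN.
  have -> : a * n.+3%:R = 1 by rewrite /a -polyC_natr -polyCM mulVf ?pnatr_eq0.
  have -> : b * n.+1%:R = 1 by rewrite /b -polyC_natr -polyCM mulVf ?pnatr_eq0.
  by rewrite (chebSS n.+1) (chebSS n); ring.
pose F t := Num.sqrt (4 - t ^+ 2) * q.[t].
have cF : continuous F.
  move=> t; apply: cvgM; first exact: continuous_sqrt_4B.
  exact: continuous_horner.
have dF t : -2 < t < 2 ->
    is_derive t 1 F (Num.sqrt (4 - t ^+ 2) * (chebS n.+1).[t]).
  move=> t2; have D1 := is_derive_sqrt_4B t t2.
  have h : 0 < 4 - t ^+ 2 by nra.
  have s0 : Num.sqrt (4 - t ^+ 2) != 0 by rewrite gt_eqF// sqrtr_gt0.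
  have ss : Num.sqrt (4 - t ^+ 2) ^+ 2 = 4 - t ^+ 2 by rewrite sqr_sqrtr// ltW.
  have := is_deriveM D1 (is_derive_poly q t).
  move=> /is_derive_eq; apply; rewrite /GRing.scale/=.
  have := congr1 (fun p => p.[t]) Lq.
  have e4 : (4 : {poly R}).[t] = 4 by rewrite -[4]polyC_natr hornerC.
  rewrite !(e4, hornerM, hornerD, hornerN, hornerXn, hornerX) -[X in X * _]ss.
  rewrite -[X in _ = X * _]ss.
  set s := Num.sqrt _ in s0 *; move: q^`().[t] q.[t] (chebS n.+1).[t].
  move=> q' q0 c E; apply: (mulfI s0).
  by transitivity (s ^+ 2 * c); [rewrite -E; field | ring].
rewrite (@continuous_FTC2 _ _ F).
- rewrite /F; have -> : (4 - 2 ^+ 2 = 0 :> R) by ring.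
  have -> : (4 - (-2) ^+ 2 = 0 :> R) by ring.
  by rewrite sqrtr0 !mul0r sube0.
- lra.
- apply: continuous_subspaceT => t; apply: cvgM.
    exact: continuous_sqrt_4B.
  exact: continuous_horner.
- split.
  + by move=> t; rewrite in_itv/= => t2; have [] := dF t t2.
  + exact/cvg_at_right_filter/cF.
  + exact/cvg_at_left_filter/cF.
- move=> t; rewrite in_itv/= => t2; have D := dF t t2.
  by rewrite derive1E derive_val.
Qed.

End ChebyshevS.

Section Density.
Context {R : realType}.
Notation lam := (@lebesgue_measure R).

Lemma Rintegral_density_measurableTypeR (P : probability (measurableTypeR R) R)
    (g f : R -> R) (E : set R) :
  (forall x, 0 <= g x) -> measurable_fun setT g ->
  (forall A, measurable A -> P A = (\int[lam]_(x in A) (g x)%:E)%E) ->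
  measurable E -> P.-integrable E (EFin \o f) ->
  \int[P]_(x in E) f x = \int[lam]_(x in E) (f x * g x).
Proof.
move=> g0 mg PE mE iF.
have dom : P `<< lam.
  apply/null_content_dominatesP => A mA A0.
  rewrite PE//; apply: null_set_integral => //.
  exact/measurable_EFinP/measurable_funTS.
have ig : lam.-integrable setT (EFin \o g).
  apply/integrableP; split; first exact/measurable_EFinP.
  under eq_integral do rewrite /= ger0_norm//.
  by rewrite -PE// probability_setT ltry.
rewrite /Rintegral; congr fine.
rewrite -(@Radon_Nikodym_change_of_variables _ (measurableTypeR R) R P lam dom _ _ mE iF).
have mf : measurable_fun E (EFin \o f) by case/integrableP : iF.
apply: ae_eq_integral => //.
- apply: emeasurable_funM => //; apply: (measurable_int lam).
  apply: (integrableS _ _ (@subsetT _ _)) => //=.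
  by apply: Radon_Nikodym_integrable; exact: dom.
- under eq_fun do rewrite EFinM.
  apply: emeasurable_funM => //=.
  exact/measurable_EFinP/measurable_funTS.
- under [X in ae_eq _ _ _ X]eq_fun do rewrite EFinM.
  apply: ae_eqe_mul2l => /=.
  rewrite Radon_NikodymE /=.
  case: cid => /= h [h1 h2 h3].
  apply: integral_ae_eq => //=.
  + exact: integrableS h2.
  + exact/measurable_EFinP/measurable_funTS.
  + by move=> B BE mB; rewrite -h3//= PE.
Qed.

Let toTR : R -> measurableTypeR R := idfun.

#[local] HB.instance Definition _ :=
  @isMeasurableFun.Build _ _ _ _ toTR (@measurable_id _ _ setT).

(* The Borel structures on [R] and [measurableTypeR R] have the same measurable
   sets but distinct displays, so [P] is transported along the identity. *)
Lemma Rintegral_density (P : probability R R) (g f : R -> R) (E : set R) :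
  (forall x, 0 <= g x) -> measurable_fun setT g ->
  (forall A, measurable A -> P A = (\int[lam]_(x in A) (g x)%:E)%E) ->
  measurable E -> measurable_fun setT f -> P.-integrable E (EFin \o f) ->
  \int[P]_(x in E) f x = \int[lam]_(x in E) (f x * g x).
Proof.
move=> g0 mg PE mE mf iF.
pose Q := distribution P (toTR : {RV P >-> measurableTypeR R}).
have mF : measurable_fun setT (EFin \o f) by exact/measurable_EFinP.
have iQ : Q.-integrable E (EFin \o f) by exact: integrable_pushforward.
rewrite -(@Rintegral_density_measurableTypeR Q g f E)//.
by rewrite /Rintegral integral_pushforward.
Qed.

End Density.

Section CauchyKernels.
Context {R : realType}.
Implicit Types (P : probability R R) (x y t : R).

Definition conj_poisson x y t := (x - t) / ((x - t) ^+ 2 + y ^+ 2).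
Definition poisson x y t := y / ((x - t) ^+ 2 + y ^+ 2).

Lemma cauchy_denom_gt0 x y t : 0 < y -> 0 < (x - t) ^+ 2 + y ^+ 2.
Proof. by move=> y0; rewrite ltr_wpDl ?sqr_ge0// exprn_gt0. Qed.

Lemma cauchyE P x y : Defs.cauchy P (Complex x y) =
  Complex (\int[P]_t conj_poisson x y t) (\int[P]_t (- poisson x y t)).
Proof.
rewrite /Defs.cauchy; congr Complex; apply: eq_Rintegral => t _ /=;
  by rewrite subr0.
Qed.

Lemma continuous_cauchy_denomV x y : 0 < y ->
  continuous (fun t => ((x - t) ^+ 2 + y ^+ 2)^-1).
Proof.
move=> y0 t; apply: cvgV; first by rewrite gt_eqF// cauchy_denom_gt0.
apply: cvgD; last exact: cvg_cst.
apply: (@continuous_comp _ _ _ (fun u : R => x - u) (fun u => u ^+ 2)).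
  by apply: cvgB; [exact: cvg_cst | exact: cvg_id].
exact: exprn_continuous.
Qed.

Lemma continuous_conj_poisson x y : 0 < y -> continuous (conj_poisson x y).
Proof.
move=> y0 t; apply: cvgM; last exact: continuous_cauchy_denomV.
by apply: cvgB; [exact: cvg_cst | exact: cvg_id].
Qed.

Lemma continuous_poisson x y : 0 < y -> continuous (poisson x y).
Proof.
by move=> y0 t; apply: cvgM; [exact: cvg_cst | exact: continuous_cauchy_denomV].
Qed.

Lemma poisson_gt0 x y t : 0 < y -> 0 < poisson x y t.
Proof. by move=> y0; rewrite divr_gt0// cauchy_denom_gt0. Qed.

Lemma poisson_le x y t : 0 < y -> poisson x y t <= y^-1.
Proof.
move=> y0; rewrite ler_pdivrMr ?cauchy_denom_gt0// mulrDr.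
have -> : y^-1 * y ^+ 2 = y by field; rewrite gt_eqF.
by rewrite lerDr mulr_ge0 ?sqr_ge0// invr_ge0 ltW.
Qed.

Lemma conj_poisson_le x y t : 0 < y -> `|conj_poisson x y t| <= y^-1.
Proof.
move=> y0; have d0 := cauchy_denom_gt0 x y t y0.
rewrite normrM normfV (gtr0_norm d0) ler_pdivrMr// ler_pdivlMl//.
rewrite -[(x - t) ^+ 2]real_normK ?num_real//.
by have := normr_ge0 (x - t); nra.
Qed.

Lemma integrable_bounded_continuous P (A : set R) (f : R -> R) (M : R) :
  measurable A -> continuous f -> (forall t, A t -> `|f t| <= M) ->
  P.-integrable A (EFin \o f).
Proof.
move=> mA cf fM; apply: measurable_bounded_integrable => //.
- by apply: le_lt_trans (probability_le1 P mA) _; rewrite ltry.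
- by apply: measurable_funTS; apply: continuous_measurable_fun.
- exists M; split; first exact: num_real.
  by move=> N MN t At; exact: le_trans (fM t At) (ltW MN).
Qed.

Lemma integrable_continuous_itv P (a b : R) (f : R -> R) : continuous f ->
  P.-integrable `[a, b] (EFin \o f).
Proof.
move=> cf.
have /compact_bounded [M [_ fM]] : compact (f @` `[a, b]).
  by apply: continuous_compact; [exact: continuous_subspaceT | exact: segment_compact].
apply: (@integrable_bounded_continuous _ _ _ (M + 1)) => // t abt.
by apply: (fM (M + 1)); [rewrite ltrDl | exists t].
Qed.

Lemma integrable_poisson P (A : set R) x y : measurable A -> 0 < y ->
  P.-integrable A (EFin \o poisson x y).
Proof.
move=> mA y0; apply: (@integrable_bounded_continuous _ _ _ y^-1) => //.
  exact: continuous_poisson.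
by move=> t _; rewrite gtr0_norm ?poisson_gt0// poisson_le.
Qed.

Lemma integrable_conj_poisson P (A : set R) x y : measurable A -> 0 < y ->
  P.-integrable A (EFin \o conj_poisson x y).
Proof.
move=> mA y0; apply: (@integrable_bounded_continuous _ _ _ y^-1) => //.
  exact: continuous_conj_poisson.
by move=> t _; rewrite conj_poisson_le.
Qed.

End CauchyKernels.

Section SemicircleMoments.
Context {R : realType} (sc : probability R R).
Hypothesis scP : is_semicircle sc.
Notation D := (`[(-2)%R, 2%R]%classic : set R).

Lemma semicircle_pdfE (x : R) :
  semicircle_pdf x = Num.sqrt (4 - x ^+ 2) / (2 * pi).
Proof.
rewrite /semicircle_pdf; case: ifPn => //.
rewrite -ltNge => x2; rewrite ler0_sqrtr ?mul0r// subr_le0.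
by rewrite -[x ^+ 2]real_normK ?num_real//; nra.
Qed.

Lemma semicircle_pdf_ge0 (x : R) : 0 <= semicircle_pdf x.
Proof. by rewrite semicircle_pdfE divr_ge0 ?sqrtr_ge0// mulr_ge0// pi_ge0. Qed.

Lemma measurable_semicircle_pdf : measurable_fun setT (@semicircle_pdf R).
Proof.
apply: continuous_measurable_fun.
rewrite (_ : semicircle_pdf = fun x => Num.sqrt (4 - x ^+ 2) / (2 * pi)).
  by move=> t; apply: cvgM; [exact: continuous_sqrt_4B | exact: cvg_cst].
by apply/funext => x; rewrite semicircle_pdfE.
Qed.

Lemma semicircle_setCD : sc (~` D) = 0.
Proof.
have mD : measurable (~` D) by apply: measurableC.
rewrite scP//; apply: integral0_eq => x /=; rewrite in_itv/= => x2.
rewrite semicircle_pdfE ler0_sqrtr ?mul0r// subr_le0 leNgt; apply/negP => h.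
by apply: x2; nra.
Qed.

Lemma Rintegral_semicircleT (f : R -> R) : sc.-integrable setT (EFin \o f) ->
  \int[sc]_x f x = \int[sc]_(x in D) f x.
Proof.
move=> iF; rewrite /Rintegral; congr fine.
rewrite (@negligible_integral _ _ _ sc setT (~` D))//.
- by rewrite setTD setCK.
- by apply: measurableC.
- exact: semicircle_setCD.
Qed.

Lemma semicircle_moment (n : nat) :
  \int[sc]_(x in D) (chebS n).[x] = (n == 0%N)%:R.
Proof.
case: n => [|n] /=.
  under eq_Rintegral do rewrite hornerC.
  rewrite -Rintegral_semicircleT; last first.
    by apply: (@integrable_bounded_continuous _ _ _ _ 1) => // t; [exact: cvg_cst|rewrite normr1].
  by rewrite Rintegral_cst// mul1r; exact: (congr1 fine (probability_setT sc)).
transitivity (\int[lebesgue_measure]_(x in D) ((chebS n.+1).[x] * semicircle_pdf x)).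
  apply: Rintegral_density => //.
  - exact: semicircle_pdf_ge0.
  - exact: measurable_semicircle_pdf.
  - by apply: continuous_measurable_fun; exact: continuous_horner.
  - by apply: integrable_continuous_itv; exact: continuous_horner.
under eq_Rintegral do rewrite semicircle_pdfE mulrA (mulrC _.[_]).
rewrite RintegralZr//; last first.
  apply: continuous_compact_integrable; first exact: segment_compact.
  apply: continuous_subspaceT => t; apply: cvgM; first exact: continuous_sqrt_4B.
  exact: continuous_horner.
by rewrite /Rintegral integral_chebS mul0r.
Qed.

End SemicircleMoments.

Section SemicircleCauchy.
Context {R : realType}.

Lemma exprn_ge1D (N : R) (n : nat) : 1 <= N -> 1 + n%:R * (N - 1) <= N ^+ n.
Proof.
move=> N1; elim: n => [|n IH]; first by rewrite mul0r addr0 expr0.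
rewrite exprS -(natr1 n); have n0 : 0 <= n%:R :> R by rewrite ler0n.
by have : 0 <= n%:R * (N - 1) by [rewrite mulr_ge0// subr_ge0]; nra.
Qed.

Lemma geometric_le_square_eq0 (N C d : R) : 1 < N -> 0 <= d ->
  (forall n : nat, N ^+ n * d <= C * n.+1%:R ^+ 2) -> d = 0.
Proof.
move=> N1 d0 H; apply/eqP; rewrite eq_le d0 andbT leNgt; apply/negP => dp.
pose h := N - 1; have h0 : 0 < h by rewrite subr_gt0.
have key (k : nat) : (k.+1%:R * h ^+ 3) * d <= C * 16.
  have := H (3 * k.+1)%N; rewrite mulnC exprM.
  have e1 := exprn_ge1D N k.+1 (ltW N1); rewrite -/h in e1.
  set u := N ^+ k.+1 in e1 *; set m : R := k.+1%:R in e1 *.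
  have m1 : 1 <= m by rewrite /m ler1n.
  have -> : (k.+1 * 3).+1%:R = 3 * m + 1 :> R by rewrite -natr1 natrM mulrC.
  move=> H'.
  have C0 : 0 <= C.
    have : 0 <= N ^+ 0 * d by rewrite mulr_ge0// exprn_ge0// (le_trans _ (ltW N1)).
    by move=> /le_trans /(_ (H 0%N)); rewrite expr1n mulr1.
  have u3 : (m * h) ^+ 3 <= u ^+ 3.
    by rewrite lerXn2r ?nnegrE//; nra.
  have : (m * h) ^+ 3 * d <= C * (16 * m ^+ 2).
    apply: le_trans (_ : u ^+ 3 * d <= _); first by rewrite ler_pM2r.
    by apply: (le_trans H'); rewrite ler_wpM2l//; nra.
  have m2 : 0 < m ^+ 2 by rewrite exprn_gt0// (lt_le_trans _ m1).
  move=> H2; rewrite -(ler_pM2r m2).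
  apply: le_trans (_ : (m * h) ^+ 3 * d <= _).
    by rewrite le_eqVlt; apply/orP; left; apply/eqP; ring.
  by apply: (le_trans H2); rewrite mulrA.
have c0 : 0 < h ^+ 3 * d by rewrite mulr_gt0// exprn_gt0.
have [k hk] : exists k : nat, C * 16 / (h ^+ 3 * d) < k.+1%:R.
  by exists (Num.truncn (C * 16 / (h ^+ 3 * d))); rewrite truncnS_gt.
have := key k; rewrite leNgt -mulrA -ltr_pdivrMr// hk.
by [].
Qed.

Definition normsq (z : R[i]) : R := complex.Re z ^+ 2 + complex.Im z ^+ 2.

Lemma normsqM z w : normsq (z * w) = normsq z * normsq w.
Proof. by case: z w => [a b] [c d]; rewrite /normsq /=; ring. Qed.

Lemma normsq_ge0 z : 0 <= normsq z.
Proof. by rewrite addr_ge0 ?sqr_ge0. Qed.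

Lemma normsq_exp z n : normsq (z ^+ n) = normsq z ^+ n.
Proof.
elim: n => [|n IH]; first by rewrite !expr0 /normsq /=; ring.
by rewrite !exprS normsqM IH.
Qed.

Lemma normsqB_le z w : normsq (z - w) <= 2 * normsq z + 2 * normsq w.
Proof.
case: z w => [a b] [c d]; rewrite /normsq /=.
by have := sqr_ge0 (a + c); have := sqr_ge0 (b + d); nra.
Qed.

Lemma normsq_eq0 z : normsq z = 0 -> z = 0.
Proof.
case: z => a b /eqP; rewrite /normsq /= paddr_eq0 ?sqr_ge0// !sqrf_eq0.
by move=> /andP[/eqP -> /eqP ->].
Qed.

Lemma complexV (a b : R) : (Complex a b)^-1 =
  Complex (a / (a ^+ 2 + b ^+ 2)) (- (b / (a ^+ 2 + b ^+ 2))).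
Proof. by []. Qed.

Variable sc : probability R R.
Hypothesis scP : is_semicircle sc.
Notation D := (`[(-2)%R, 2%R]%classic : set R).

Section ChebyshevCauchy.
Variables x y : R.
Hypothesis y0 : 0 < y.

Definition cheb_cauchy (n : nat) : R[i] :=
  Complex (\int[sc]_(t in D) ((chebS n).[t] * conj_poisson x y t))
          (- \int[sc]_(t in D) ((chebS n).[t] * poisson x y t)).

Let cont_horner_re (p : {poly R}) :
  continuous (fun t => p.[t] * conj_poisson x y t).
Proof.
move=> t; apply: cvgM; first exact: continuous_horner.
exact: continuous_conj_poisson.
Qed.

Let cont_horner_im (p : {poly R}) : continuous (fun t => p.[t] * poisson x y t).
Proof.
move=> t; apply: cvgM; first exact: continuous_horner.
exact: continuous_poisson.
Qed.

Let iD (f : R -> R) : continuous f -> sc.-integrable D (EFin \o f).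
Proof. exact: integrable_continuous_itv. Qed.

Let shift_re (p : {poly R}) : \int[sc]_(t in D) (('X * p).[t] * conj_poisson x y t) =
  x * (\int[sc]_(t in D) (p.[t] * conj_poisson x y t)) +
  y * (\int[sc]_(t in D) (p.[t] * poisson x y t)) - \int[sc]_(t in D) p.[t].
Proof.
have c1 := cont_horner_re p; have c2 := cont_horner_im p.
transitivity (\int[sc]_(t in D) (x * (p.[t] * conj_poisson x y t)
    + y * (p.[t] * poisson x y t) - p.[t])).
  apply: eq_Rintegral => t _; rewrite hornerM hornerX /conj_poisson /poisson.
  by have := cauchy_denom_gt0 x y t y0 => /gt_eqF d0; field; rewrite d0.
rewrite RintegralB//.
- rewrite RintegralD//.
  + by rewrite !RintegralZl//; apply: iD.
  + by apply: iD => t; apply: cvgM; [exact: cvg_cst | exact: c1].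
  + by apply: iD => t; apply: cvgM; [exact: cvg_cst | exact: c2].
- apply: iD => t; apply: cvgD.
  + by apply: cvgM; [exact: cvg_cst | exact: c1].
  + by apply: cvgM; [exact: cvg_cst | exact: c2].
- by apply: iD; exact: continuous_horner.
Qed.

Let shift_im (p : {poly R}) : \int[sc]_(t in D) (('X * p).[t] * poisson x y t) =
  x * (\int[sc]_(t in D) (p.[t] * poisson x y t)) -
  y * (\int[sc]_(t in D) (p.[t] * conj_poisson x y t)).
Proof.
have c1 := cont_horner_re p; have c2 := cont_horner_im p.
transitivity (\int[sc]_(t in D) (x * (p.[t] * poisson x y t)
    - y * (p.[t] * conj_poisson x y t))).
  apply: eq_Rintegral => t _; rewrite hornerM hornerX /conj_poisson /poisson.
  by have := cauchy_denom_gt0 x y t y0 => /gt_eqF d0; field; rewrite d0.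
rewrite RintegralB//.
- by rewrite !RintegralZl//; apply: iD.
- by apply: iD => t; apply: cvgM; [exact: cvg_cst | exact: c2].
- by apply: iD => t; apply: cvgM; [exact: cvg_cst | exact: c1].
Qed.

Lemma cheb_cauchy1 : cheb_cauchy 1 = Complex x y * cheb_cauchy 0 - 1.
Proof.
have e1 : chebS 1 = 'X * chebS 0 :> {poly R} by rewrite /= mulr1.
rewrite /cheb_cauchy e1 shift_re shift_im (semicircle_moment sc scP).
move: (Rintegral _ _ _) (Rintegral _ _ _) => u v.
by apply/eqP; rewrite eq_complex; apply/andP; split; apply/eqP => /=; ring.
Qed.

Lemma cheb_cauchySS n :
  cheb_cauchy n.+2 = Complex x y * cheb_cauchy n.+1 - cheb_cauchy n.
Proof.
have dist (k : R -> R) : continuous k ->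
    \int[sc]_(t in D) ((chebS n.+2).[t] * k t) =
    \int[sc]_(t in D) (('X * chebS n.+1).[t] * k t) -
    \int[sc]_(t in D) ((chebS n).[t] * k t).
  move=> ck; rewrite -RintegralB//.
  - apply: eq_Rintegral => t _.
    by rewrite chebSS [X in X * _]hornerD hornerN mulrBl.
  - by apply: iD => t; apply: cvgM; [exact: continuous_horner | exact: ck].
  - by apply: iD => t; apply: cvgM; [exact: continuous_horner | exact: ck].
rewrite /cheb_cauchy !dist; [|exact: continuous_poisson|exact: continuous_conj_poisson].
rewrite shift_re shift_im (semicircle_moment sc scP).
do 4 (move: (Rintegral _ _ _) => ?).
by apply/eqP; rewrite eq_complex; apply/andP; split; apply/eqP => /=; ring.
Qed.

Let cheb_integral_bound (k : R -> R) n : continuous k ->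
  `|\int[sc]_(t in D) ((chebS n).[t] * k t)| <=
  n.+1%:R * \int[sc]_(t in D) `|k t|.
Proof.
move=> ck.
have cn : continuous (fun t => `|k t|).
  by move=> t; apply: (@continuous_comp _ _ _ k Num.norm); [exact: ck|exact: norm_continuous].
have cSk : continuous (fun t => (chebS n).[t] * k t).
  by move=> t; apply: cvgM; [exact: continuous_horner | exact: ck].
rewrite -RintegralZl//; last exact: iD.
apply: le_trans; first by apply: le_normr_Rintegral => //; exact: iD.
apply: le_Rintegral => //.
- by apply: iD => t; apply: (@continuous_comp _ _ _ (fun t => (chebS n).[t] * k t) Num.norm);
    [exact: cSk|exact: norm_continuous].
- by apply: iD => t; apply: cvgM; [exact: cvg_cst | exact: cn].
- move=> t /=; rewrite in_itv/= => tD; rewrite normrM ler_wpM2r//.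
  by apply: chebS_bound; rewrite ler_norml.
Qed.

Lemma normsq_cheb_cauchy : exists C : R, forall n : nat,
  normsq (cheb_cauchy n) <= C * n.+1%:R ^+ 2.
Proof.
exists ((\int[sc]_(t in D) `|conj_poisson x y t|) ^+ 2
      + (\int[sc]_(t in D) `|poisson x y t|) ^+ 2) => n.
have h1 := cheb_integral_bound _ n (continuous_conj_poisson x y y0).
have h2 := cheb_integral_bound _ n (continuous_poisson x y y0).
rewrite /normsq /cheb_cauchy [complex.Re _]/= [complex.Im _]/= sqrrN mulrDl.
rewrite -!exprMn -(real_normK (num_real (\int[sc]_(t in D) (_ * conj_poisson x y t)))).
rewrite -(real_normK (num_real (\int[sc]_(t in D) (_ * poisson x y t)))).
rewrite mulrC in h1; rewrite mulrC in h2.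
by apply: lerD; apply: lerXn2r; rewrite ?nnegrE ?normr_ge0//;
  [exact: le_trans h1 | exact: le_trans h2].
Qed.

End ChebyshevCauchy.

Lemma cauchy_semicircle a b : 0 < b -> 1 < a ^+ 2 + b ^+ 2 ->
  Defs.cauchy sc (Complex (a + a / (a ^+ 2 + b ^+ 2))
                          (b - b / (a ^+ 2 + b ^+ 2))) = (Complex a b)^-1.
Proof.
move=> b0 N1; set N := a ^+ 2 + b ^+ 2 in N1 *.
have N0 : 0 < N by rewrite (lt_trans _ N1).
set x := a + _; set y := b - _.
have y0 : 0 < y by rewrite subr_gt0 ltr_pdivrMr// ltr_pMr.
pose w := Complex a b; pose g := cheb_cauchy x y.
have w0 : w != 0.
  by apply/negP => /eqP [a0 b00]; rewrite b00 ltxx in b0.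
have zE : Complex x y = w + w^-1 by [].
have gE : Defs.cauchy sc (Complex x y) = g 0%N.
  rewrite cauchyE /g /cheb_cauchy; congr Complex.
    rewrite (Rintegral_semicircleT sc scP); last exact: integrable_conj_poisson.
    by apply: eq_Rintegral => t _; rewrite /= hornerC mul1r.
  transitivity (\int[sc]_t (-1 * poisson x y t)).
    by apply: eq_Rintegral => t _; rewrite mulN1r.
  rewrite RintegralZl//; last exact: integrable_poisson.
  rewrite (Rintegral_semicircleT sc scP); last exact: integrable_poisson.
  by rewrite mulN1r; congr (- _); apply: eq_Rintegral => t _; rewrite /= hornerC mul1r.
pose d n := g n.+1 - w^-1 * g n.
have dE n : d n = w ^+ n * (w * g 0%N - 1).
  elim: n => [|n IH].
    by rewrite /d /g cheb_cauchy1// zE; ring.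
  rewrite exprS -mulrA -IH /d /g cheb_cauchySS// zE.
  by field.
have [C HC] := normsq_cheb_cauchy x y y0.
suff : normsq (w * g 0%N - 1) = 0.
  move=> /normsq_eq0 /eqP; rewrite subr_eq0 => /eqP h.
  by rewrite gE; apply: (mulfI w0); rewrite h mulfV.
apply: (@geometric_le_square_eq0 N (10 * C)) => //; first exact: normsq_ge0.
move=> n; have -> : N = normsq w by [].
rewrite -normsq_exp -normsqM -dE.
apply: (le_trans (normsqB_le _ _)); rewrite normsqM.
have wV : normsq w^-1 <= 1.
  have e : normsq w * normsq w^-1 = 1.
    by rewrite -normsqM mulfV// /normsq /=; ring.
  have N1' : 1 < normsq w by [].
  by have := normsq_ge0 w^-1; nra.
have h1 := HC n.+1; have h2 := HC n.
have g0 := normsq_ge0 (g n); have C0 : 0 <= C.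
  by have := HC 0%N; rewrite expr1n mulr1; apply: le_trans; exact: normsq_ge0.
have wg : normsq w^-1 * normsq (g n) <= normsq (g n) by rewrite ler_piMl.
apply: (@le_trans _ _ (2 * (C * n.+2%:R ^+ 2) + 2 * (C * n.+1%:R ^+ 2))).
  apply: lerD; rewrite ler_wpM2l//; exact: le_trans wg h2.
rewrite -(natr1 n.+1).
have m1 : 1 <= n.+1%:R :> R by rewrite ler1n.
rewrite !mulrA -!(mulrC C) -!mulrA -mulrDr; rewrite ler_wpM2l//.
move: n.+1%:R m1 => m m1; nra.
Qed.

End SemicircleCauchy.

Section Support.
Context {R : realType}.
Implicit Types (P : probability R R) (x y k c L : R).

Definition poisson_integral P x y := \int[P]_t poisson x y t.

Definition vanishing_density P x := exists e C : R, 0 < e /\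
  forall x' y, `|x' - x| < e -> 0 < y < e -> poisson_integral P x' y <= C * y.

Lemma Im_cauchy P x y : 0 < y ->
  complex.Im (Defs.cauchy P (Complex x y)) = - poisson_integral P x y.
Proof.
move=> y0; rewrite cauchyE /= /poisson_integral -[RHS]mulN1r.
rewrite -RintegralZl//; last exact: integrable_poisson.
by apply: eq_Rintegral => t _; rewrite mulN1r.
Qed.

Lemma null_ball_vanishing_density P x e : 0 < e -> P (ball x e) = 0%E ->
  vanishing_density P x.
Proof.
move=> e0 Pe; exists (e / 2), (4 / e ^+ 2); split; first by rewrite divr_gt0.
move=> x' y x'x /andP[y0 _].
have mB : measurable (ball x e : set R) by exact: measurable_ball.
have mBC : measurable (setT `\` ball x e : set R) by exact: measurableD.
have -> : poisson_integral P x' y = \int[P]_(t in setT `\` ball x e) poisson x' y t.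
  rewrite /poisson_integral /Rintegral; congr fine.
  by rewrite (@negligible_integral _ _ _ P setT (ball x e))//; exact: integrable_poisson.
apply: (@le_trans _ _ (\int[P]_(t in setT `\` ball x e) (4 / e ^+ 2 * y))).
  apply: le_Rintegral => //.
  - exact: integrable_poisson.
  - by apply: (@integrable_bounded_continuous _ _ _ _ `|4 / e ^+ 2 * y|) => // t; exact: cvg_cst.
  move=> t [_]; rewrite /ball/= => /negP; rewrite -leNgt => te.
  rewrite /poisson ler_pdivrMr ?cauchy_denom_gt0//.
  have h : e / 2 <= `|x' - t|.
    have := ler_distD x' x t; rewrite (distrC x x'); lra.
  have h2 : (e / 2) ^+ 2 <= (x' - t) ^+ 2.
    by rewrite -[(x' - t) ^+ 2]real_normK ?num_real// lerXn2r ?nnegrE// divr_ge0// ltW.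
  rewrite mulrAC ler_peMl ?(ltW y0)// mulrAC ler_pdivlMr ?exprn_gt0// mul1r.
  by have := sqr_ge0 y; nra.
rewrite Rintegral_cst// ler_piMr//.
  by rewrite mulr_ge0 ?divr_ge0 ?exprn_ge0 ?ltW.
by rewrite -lee_fin fineK ?fin_num_measure// probability_le1.
Qed.

Lemma poisson_integral_ge P (A : set R) x y k : measurable A -> 0 < y ->
  0 <= k -> (forall t, A t -> k <= poisson x y t) ->
  k * fine (P A) <= poisson_integral P x y.
Proof.
move=> mA y0 k0 kA.
have mp : measurable_fun setT (EFin \o poisson x y).
  apply/measurable_EFinP.
  by apply: continuous_measurable_fun; exact: continuous_poisson.
rewrite -lee_fin EFinM fineK ?fin_num_measure// -integral_cst//.
rewrite /poisson_integral /Rintegral fineK; last first.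
  by apply: integrable_fin_num => //; exact: integrable_poisson.
apply: (@le_trans _ _ (\int[P]_(t in A) (poisson x y t)%:E)%E).
  by apply: ge0_le_integral => //; exact: measurable_funTS.
apply: ge0_subset_integral => //.
by move=> t _; rewrite lee_fin ltW// poisson_gt0.
Qed.

Lemma ball_le_poisson P c L : 0 < L ->
  fine (P (ball c L)) <= 2 * L * poisson_integral P c L.
Proof.
move=> L0; have mB : measurable (ball c L : set R) by exact: measurable_ball.
rewrite -ler_pdivrMl ?mulr_gt0//; apply: poisson_integral_ge => //.
  by rewrite invr_ge0 mulr_ge0// ltW.
move=> t; rewrite /ball/= => ct.
rewrite /poisson ler_pdivlMr ?cauchy_denom_gt0// ler_pdivrMl ?mulr_gt0//.
have : (c - t) ^+ 2 <= L ^+ 2.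
  by rewrite -[(c - t) ^+ 2]real_normK ?num_real// lerXn2r ?nnegrE// ltW.
by nra.
Qed.

(* Halving the interval [k] times gains a factor [2^k] over the quadratic bound
   supplied by [ball_le_poisson]. *)
Lemma vanishing_density_itv P x e C : 0 < e ->
  (forall x' y, `|x' - x| < e -> 0 < y < e -> poisson_integral P x' y <= C * y) ->
  forall (k : nat) c L, 0 < L < e -> x - e < c -> c + L < x + e ->
    (P `[c, (c + L)%R[%classic <= (2 * C * L ^+ 2 / 2 ^+ k)%:E)%E.
Proof.
move=> e0 H; elim=> [|k IH] c L /andP[L0 Le] c1 c2.
  apply: (@le_trans _ _ (P (ball (c + L / 2) L))).
    apply: le_measure; rewrite ?inE//; first exact: measurable_ball.
    move=> t /=; rewrite in_itv/= => /andP[h1 h2].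
    by rewrite /ball/= ltr_norml; lra.
  rewrite -[leLHS]fineK ?fin_num_measure//; last exact: measurable_ball.
  rewrite lee_fin expr0 divr1; apply: (le_trans (ball_le_poisson P (c + L / 2) L L0)).
  have -> : 2 * C * L ^+ 2 = 2 * L * (C * L) by ring.
  rewrite ler_pM2l ?mulr_gt0//; apply: H; first by rewrite ltr_norml; lra.
  by rewrite L0.
have -> : `[c, (c + L)%R[%classic =
    (`[c, (c + L / 2)%R[ `|` `[(c + L / 2)%R, (c + L / 2 + L / 2)%R[)%classic :> set R.
  apply/seteqP; split => t /=; rewrite !in_itv/=.
    move=> /andP[h1 h2]; case: (ltP t (c + L / 2)) => h3; [left|right].
      by rewrite h1.
    by rewrite -addrA -splitr h2.
  by case=> /andP[h1 h2]; apply/andP; split; lra.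
apply: (le_trans (measureU2 _ _ _)) => //.
have -> : (2 * C * L ^+ 2 / 2 ^+ k.+1)%:E = ((2 * C * (L / 2) ^+ 2 / 2 ^+ k)%:E
    + (2 * C * (L / 2) ^+ 2 / 2 ^+ k)%:E)%E.
  rewrite -EFinD (exprS (2 : R) k); congr EFin; field.
  by rewrite expf_neq0.
by apply: leeD; apply: IH; lra.
Qed.

Lemma msupportP P x : msupport P x <-> ~ vanishing_density P x.
Proof.
split.
  move=> xP [e [C [e0 H]]].
  have : fine (P (ball x (e / 4))) = 0.
    apply: (@geometric_le_square_eq0 _ 2 (2 * C * (e / 2) ^+ 2)) => //.
    - by rewrite ltr1n.
    - by rewrite fine_ge0.
    move=> n.
    have h : (P (ball x (e / 4)) <= (2 * C * (e / 2) ^+ 2 / 2 ^+ n)%:E)%E.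
      apply: le_trans (@vanishing_density_itv P x e C e0 H n (x - e / 4) (e / 2) _ _ _); [|lra..].
      apply: le_measure; rewrite ?inE//; first exact: measurable_ball.
      by move=> t; rewrite /ball/= ltr_norml in_itv/=; lra.
    rewrite -[X in (X <= _)%E]fineK ?fin_num_measure// in h; last exact: measurable_ball.
    rewrite lee_fin ler_pdivlMr ?exprn_gt0// mulrC in h.
    apply: (le_trans h); rewrite ler_peMr//.
      by apply: le_trans h; rewrite mulr_ge0 ?exprn_ge0 ?fine_ge0.
    by rewrite -[leLHS](expr1n _ 2) lerXn2r ?nnegrE// ler1n.
  have e4 : 0 < e / 4 by rewrite divr_gt0.
  have := xP _ e4; rewrite -[X in (_ < X)%E]fineK; last first.
    by rewrite fin_num_measure//; exact: measurable_ball.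
  by move=> + h; rewrite h ltxx.
move=> nv e e0; rewrite lt0e measure_ge0 andbT; apply/eqP => Pe.
exact/nv/null_ball_vanishing_density/Pe.
Qed.

End Support.

Section Joukowski.
Context {R : realType}.

Lemma joukowski_upper_half (x y : R) : 0 < y -> exists a b : R,
  [/\ 0 < b, 1 < a ^+ 2 + b ^+ 2, x = a + a / (a ^+ 2 + b ^+ 2) &
      y = b - b / (a ^+ 2 + b ^+ 2)].
Proof.
move=> y0; pose z := Complex x y.
pose w := (z + sqrtc (z ^+ 2 - 4)) / 2.
have wz : w ^+ 2 - z * w + 1 = 0.
  rewrite /w; have := sqr_sqrtc (z ^+ 2 - 4); set s := sqrtc _ => ss.
  have two0 : (2 : R[i]) != 0 by rewrite pnatr_eq0.
  transitivity ((s ^+ 2 - (z ^+ 2 - 4)) / 4); last by rewrite ss subrr mul0r.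
  by field.
have w0 : w != 0.
  apply/eqP => w0; move: wz; rewrite w0 expr0n mulr0 subr0 add0r => /eqP.
  by rewrite oner_eq0.
have {wz} : z = w + w^-1.
  apply: (mulIf w0); rewrite mulrDl mulVf// -expr2; apply/eqP.
  by rewrite -subr_eq0 -oppr_eq0 -wz; apply/eqP; ring.
case: w w0 => a b w0; rewrite /z complexV => -[xE yE].
have N0 : 0 < a ^+ 2 + b ^+ 2.
  rewrite lt_neqAle addr_ge0 ?sqr_ge0// andbT eq_sym.
  by apply: contraNneq w0 => /(@normsq_eq0 _ (Complex a b)) ->.
case: (ltgtP 1 (a ^+ 2 + b ^+ 2)) => N1.
- exists a, b; split => //.
  move: y0; rewrite yE; have -> : b - b / (a ^+ 2 + b ^+ 2) =
    b * (1 - (a ^+ 2 + b ^+ 2)^-1) by rewrite mulrBr mulr1.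
  by rewrite pmulr_lgt0// subr_gt0 invf_lt1.
- set N := a ^+ 2 + b ^+ 2 in N0 N1 xE yE.
  have Nn0 : N != 0 by rewrite gt_eqF.
  have NE : (a / N) ^+ 2 + (- (b / N)) ^+ 2 = N^-1.
    transitivity ((a ^+ 2 + b ^+ 2) / N ^+ 2); first by field.
    by rewrite -/N; field.
  exists (a / N), (- (b / N)); rewrite NE invrK; split.
  + move: y0; rewrite yE; have -> : b - b / N = (- (b / N)) * (1 - N) by field.
    by rewrite pmulr_lgt0// subr_gt0.
  + by rewrite invf_gt1.
  + by rewrite xE divfK// addrC.
  + by rewrite yE mulNr divfK// opprK addrC.
- by move: y0; rewrite yE -N1 divr1 subrr ltxx.
Qed.

Lemma joukowski_real (x : R) : 2 < `|x| -> exists2 u, 1 < `|u| & x = u + u^-1.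
Proof.
have pos (v : R) : 2 < v -> exists2 u, 1 < u & v = u + u^-1.
  move=> v2; have h : 0 < v ^+ 2 - 4 by nra.
  pose s := Num.sqrt (v ^+ 2 - 4).
  have ss : s ^+ 2 = v ^+ 2 - 4 by rewrite sqr_sqrtr ?ltW.
  have s0 : 0 < s by rewrite sqrtr_gt0.
  exists ((v + s) / 2); first lra.
  have -> : ((v + s) / 2)^-1 = (v - s) / 2; last by field.
  have vs : v + s != 0 by rewrite gt_eqF; lra.
  apply: (@mulfI _ ((v + s) / 2)); first by rewrite mulf_neq0// invr_eq0.
  rewrite mulfV ?mulf_neq0// ?invr_eq0//.
  by apply: (@mulfI _ 4) => //; transitivity (v ^+ 2 - s ^+ 2); [rewrite ss|]; field.
case: (ger0P x) => x0 x2.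
  have [u u1 xu] := pos x x2; exists u => //.
  by rewrite gtr0_norm// (lt_trans _ u1).
have [u u1 xu] := pos (- x) x2; exists (- u).
  by rewrite normrN gtr0_norm// (lt_trans _ u1).
by rewrite invrN -opprD -xu opprK.
Qed.

Lemma normr_joukowski (u : R) : `|u + u^-1| = `|u| + `|u|^-1.
Proof.
case: (ger0P u) => u0; first by rewrite ger0_norm// addr_ge0// invr_ge0.
by rewrite ltr0_norm ?opprD ?invrN// addrC ltr_nDl ?invr_lt0.
Qed.

Lemma joukowski_mono (u v : R) : 1 <= u -> u < v -> u + u^-1 < v + v^-1.
Proof.
move=> u1 uv; rewrite -subr_gt0.
have u0 : 0 < u by rewrite (lt_le_trans _ u1).
have v0 : 0 < v by rewrite (lt_trans u0).
have -> : v + v^-1 - (u + u^-1) = (v - u) * (u * v - 1) / (u * v).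
  by field; rewrite !gt_eqF.
by rewrite divr_gt0 ?mulr_gt0 ?subr_gt0//; nra.
Qed.

End Joukowski.

Section SupportStep.
Context {R : realType} {mu rho : probability R R}.

Hypothesis conv : forall a b : R, 0 < b -> 1 < a ^+ 2 + b ^+ 2 ->
  poisson_integral rho (a + a / (a ^+ 2 + b ^+ 2)) (b - b / (a ^+ 2 + b ^+ 2)) =
  poisson_integral mu a b.

Lemma msupport_conv_lt2 (t0 x : R) : msupport mu t0 -> `|x| < 2 ->
  msupport rho x.
Proof.
move=> mut0 x2; apply/msupportP => -[e [C [e0 H]]].
move: x2; rewrite ltr_norml => /andP[x1 x2].
pose c := x / 2; have c1 : c ^+ 2 < 1 by rewrite /c; nra.
pose s := Num.sqrt (1 - c ^+ 2).
have s0 : 0 < s by rewrite sqrtr_gt0 subr_gt0.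
have ss : s ^+ 2 = 1 - c ^+ 2 by rewrite sqr_sqrtr// subr_ge0 ltW.
have s1 : s <= 1 by have := sqr_ge0 c; nra.
pose B := ball t0 1 : set R; have mB : measurable B by exact: measurable_ball.
have p0 : 0 < fine (mu B).
  by rewrite -lte_fin fineK ?fin_num_measure//; exact: mut0.
pose k := s / ((`|t0| + 3) ^+ 2 + 4).
have k0 : 0 < k.
  by rewrite divr_gt0// ltr_wpDl ?sqr_ge0.
pose dl := k * fine (mu B); have dl0 : 0 < dl by rewrite mulr_gt0.
have [h [h0 h1 he hd]] : exists h : R, [/\ 0 < h, h <= 1, 2 * h < e & 2 * `|C| * h < dl].
  exists (Num.min 1 (Num.min (e / 4) (dl / (4 * (`|C| + 1))))).
  have C1 : 0 < `|C| + 1 by rewrite ltr_wpDl.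
  have q0 : 0 < dl / (4 * (`|C| + 1)) by rewrite divr_gt0// mulr_gt0.
  set m := Num.min _ _.
  have m1 : m <= 1 by rewrite /m ge_min lexx.
  have m2 : m <= e / 4 by rewrite /m !ge_min lexx orbT.
  have m3 : m <= dl / (4 * (`|C| + 1)) by rewrite /m !ge_min lexx !orbT.
  have m0 : 0 < m by rewrite /m !lt_min ltr01 q0 divr_gt0.
  split => //; first lra.
  move: m3; rewrite ler_pdivlMr ?mulr_gt0// => m3.
  have := normr_ge0 C; nra.
pose r := 1 + h; have r0 : 0 < r by rewrite /r; lra.
have rn0 : r != 0 by rewrite gt_eqF.
have NE : (r * c) ^+ 2 + (r * s) ^+ 2 = r ^+ 2.
  by transitivity (r ^+ 2 * (c ^+ 2 + s ^+ 2)); [ring | rewrite ss; ring].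
have b0 : 0 < r * s by rewrite mulr_gt0.
have N1 : 1 < (r * c) ^+ 2 + (r * s) ^+ 2 by rewrite NE /r; nra.
have E := conv _ _ b0 N1; rewrite NE in E.
have rV : r^-1 <= 1 by rewrite invf_le1// /r; lra.
have rV2 : 1 - h <= r^-1.
  by rewrite -[r^-1]mul1r ler_pdivlMr// /r; nra.
have rV0 : 0 < r^-1 by rewrite invr_gt0.
have rV1 : r^-1 < 1 by rewrite invf_lt1// /r; lra.
have e1 : r * c + r * c / r ^+ 2 = x + c * (h - 1 + r^-1).
  by rewrite /r /c; field; rewrite -/r.
have e2 : r * s - r * s / r ^+ 2 = s * (r - r^-1) by field.
have lb : dl <= poisson_integral mu (r * c) (r * s).
  apply: poisson_integral_ge => //; first exact: ltW.
  move=> t; rewrite /B/ball/= => tt0.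
  rewrite /k /poisson ler_pdivrMr ?ltr_wpDl ?sqr_ge0//.
  rewrite mulrAC ler_pdivlMr ?cauchy_denom_gt0//.
  have rcle : `|r * c| <= 2.
    rewrite normrM (gtr0_norm r0).
    have : `|c| <= 1 by rewrite -(ler_pXn2r (n := 2)) ?nnegrE// real_normK ?num_real// expr1n ltW.
    by have := normr_ge0 c; rewrite /r; nra.
  have dist : `|r * c - t| <= `|t0| + 3.
    have -> : r * c - t = r * c + (- t0) + (t0 - t) by ring.
    apply: (le_trans (ler_normD _ _)); apply: (le_trans (lerD (ler_normD _ _) (lexx _))).
    by rewrite normrN; lra.
  have d2 : (r * c - t) ^+ 2 <= (`|t0| + 3) ^+ 2.
    by rewrite -[(r * c - t) ^+ 2]real_normK ?num_real// lerXn2r ?nnegrE// addr_ge0.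
  have rs2 : (r * s) ^+ 2 <= 4 by rewrite exprMn /r; nra.
  rewrite mulrAC [leLHS]mulrC; set Q := (_ + 4); set Q' := (_ + (r * s) ^+ 2).
  have QQ : Q' <= Q by rewrite /Q /Q' lerD.
  have Q'0 : 0 < Q' by rewrite cauchy_denom_gt0.
  rewrite ler_pM2r//.
  by apply: (le_trans QQ); rewrite ler_peMl// /r; nra.
have ub : poisson_integral mu (r * c) (r * s) <= C * (s * (r - r^-1)).
  rewrite -E e1 e2; apply: H.
    rewrite addrC addKr normrM.
    have c1' : `|c| <= 1.
      by rewrite -(ler_pXn2r (n := 2)) ?nnegrE// real_normK ?num_real// expr1n ltW.
    rewrite (@ger0_norm _ (h - 1 + r^-1)); last lra.
    by have := normr_ge0 c; nra.
  by apply/andP; split; rewrite /r in rV1 *; nra.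
have : C * (s * (r - r^-1)) <= `|C| * (2 * h).
  apply: le_trans (_ : `|C| * (s * (r - r^-1)) <= _).
    by rewrite ler_wpM2r ?ler_norm// mulr_ge0 ?ltW// subr_gt0 /r; lra.
  by rewrite ler_wpM2l// /r; nra.
by lra.
Qed.

Lemma msupport_conv_le2 (t0 x : R) : msupport mu t0 -> `|x| <= 2 ->
  msupport rho x.
Proof.
move=> mut0 x2 e e0.
pose d := Num.min (e / 4) 1.
have d0 : 0 < d by rewrite lt_min ltr01 divr_gt0.
have d1 : d <= 1 by rewrite ge_min lexx orbT.
have de : d <= e / 4 by rewrite ge_min lexx.
have x'2 : `|x * (1 - d / 2)| < 2.
  rewrite normrM (@ger0_norm _ (1 - d / 2)); last lra.
  by have := normr_ge0 x; nra.
have e2 : 0 < e / 2 by rewrite divr_gt0.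
apply: lt_le_trans (msupport_conv_lt2 _ _ mut0 x'2 _ e2) _.
apply: le_measure; rewrite ?inE; [exact: measurable_ball..|].
move=> t; rewrite /ball/= => h.
have -> : x - t = x * (d / 2) + (x * (1 - d / 2) - t) by ring.
apply: (le_lt_trans (ler_normD _ _)); rewrite normrM (@ger0_norm _ (d / 2)); last lra.
by have := normr_ge0 x; nra.
Qed.

Lemma msupport_conv_gt2 (u : R) : 1 < `|u| ->
  msupport rho (u + u^-1) <-> msupport mu u.
Proof.
move=> u1; have un0 : u != 0 by rewrite -normr_gt0 (lt_trans _ u1).
have uu : `|u| ^+ 2 = u ^+ 2 by rewrite real_normK ?num_real.
rewrite !msupportP; split; apply: contra_not => -[e [C [e0 H]]]; last first.
- pose e' := Num.min (e / 3) (`|u| - 1).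
  have e'0 : 0 < e' by rewrite lt_min divr_gt0 ?subr_gt0.
  have e'1 : e' <= e / 3 by rewrite ge_min lexx.
  have e'2 : e' <= `|u| - 1 by rewrite ge_min lexx orbT.
  exists e', `|C|; split => // a b au /andP[b0 be].
  have a1 : 1 < `|a|.
    by have := ler_normB a (a - u); rewrite subKr; lra.
  have aa : `|a| ^+ 2 = a ^+ 2 by rewrite real_normK ?num_real.
  have N1 : 1 < a ^+ 2 + b ^+ 2 by rewrite -aa; have := sqr_ge0 b; nra.
  rewrite -conv//; set N := a ^+ 2 + b ^+ 2 in N1 *.
  have N0 : 0 < N by rewrite (lt_trans _ N1).
  have bN : b / N < b by rewrite ltr_pdivrMr// ltr_pMr.
  have bN0 : 0 < b / N by rewrite divr_gt0.
  apply: (@le_trans _ _ (C * (b - b / N))).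
    apply: H; last by apply/andP; split; lra.
    have -> : a + a / N - (u + u^-1) = (a - u) + (a * (u - a) - b ^+ 2) / (N * u).
      rewrite /N; field; rewrite un0 /= -/N; by rewrite gt_eqF.
    apply: (le_lt_trans (ler_normD _ _)).
    suff : `|(a * (u - a) - b ^+ 2) / (N * u)| <= `|a - u| + b by lra.
    have Nu : 0 < N * `|u| by rewrite mulr_gt0// (lt_trans _ u1).
    rewrite normrM normfV normrM (gtr0_norm N0) ler_pdivrMr//.
    apply: (le_trans (ler_normB _ _)).
    rewrite normrM (@ger0_norm _ (b ^+ 2)) ?sqr_ge0// (distrC u a) mulrDl.
    have aN : `|a| <= N by rewrite /N -aa; have := sqr_ge0 b; nra.
    have bbN : b <= N by rewrite /N -aa; have := sqr_ge0 (b - 1); nra.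
    apply: lerD.
      rewrite mulrC ler_wpM2l//; apply: (le_trans aN).
      by rewrite ler_peMr// ltW.
    rewrite expr2 ler_pM2l//; apply: (le_trans bbN).
    by rewrite ler_peMr// ltW.
  apply: (@le_trans _ _ (`|C| * (b - b / N))).
    by rewrite ler_wpM2r ?ler_norm//; lra.
  by rewrite ler_wpM2l//; lra.
- pose q := `|u| - 1; have q0 : 0 < q by rewrite subr_gt0.
  pose kp := `|u| / q; have kp0 : 0 < kp by rewrite divr_gt0// (lt_trans _ u1).
  pose eta := Num.min e (q / 2).
  have eta0 : 0 < eta by rewrite lt_min e0 divr_gt0.
  have eta1 : eta <= e by rewrite ge_min lexx.
  have eta2 : eta <= q / 2 by rewrite ge_min lexx orbT.
  pose r := 1 + q / 2; have r1 : 1 < r by rewrite /r; lra.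
  pose M := (1 - (r ^+ 2)^-1)^-1.
  have r21 : (r ^+ 2)^-1 < 1 by rewrite invf_lt1 ?exprn_gt0//; nra.
  have M0 : 0 < M by rewrite invr_gt0 subr_gt0.
  exists (eta / (2 * kp)), (`|C| * M); split.
    by rewrite divr_gt0// mulr_gt0.
  move=> x y xu /andP[y0 ye].
  have [a [b [b0 N1 xE yE]]] := joukowski_upper_half x y y0.
  set N := a ^+ 2 + b ^+ 2 in N1 xE yE.
  have N0 : 0 < N by rewrite (lt_trans _ N1).
  have Nn0 : N != 0 by rewrite gt_eqF.
  have aa : `|a| ^+ 2 = a ^+ 2 by rewrite real_normK ?num_real.
  (* With [w = a + ib], [w + 1/w - (u + 1/u) = (w - u) (1 - 1/(w u))]. *)
  have id : N * u ^+ 2 * ((x - (u + u^-1)) ^+ 2 + y ^+ 2) =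
      ((a - u) ^+ 2 + b ^+ 2) * ((a * u - 1) ^+ 2 + (b * u) ^+ 2).
    have -> : (a * u - 1) ^+ 2 + (b * u) ^+ 2 = N * u ^+ 2 - 2 * a * u + 1.
      by rewrite /N; ring.
    have -> : x - (u + u^-1) = ((a - u) * (N * u) + a * u - N) / (N * u).
      by rewrite xE; field; rewrite un0 Nn0.
    have -> : y = b * (N - 1) / N by rewrite yE; field.
    have b2 : b ^+ 2 = N - a ^+ 2 by rewrite /N; ring.
    transitivity ((((a - u) * (N * u) + a * u - N) ^+ 2 + u ^+ 2 * b ^+ 2 * (N - 1) ^+ 2) / N).
      by field; rewrite un0 Nn0.
    by rewrite b2; field.
  have low : N * q ^+ 2 <= (a * u - 1) ^+ 2 + (b * u) ^+ 2.
    have -> : (a * u - 1) ^+ 2 + (b * u) ^+ 2 = N * `|u| ^+ 2 - 2 * (a * u) + 1.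
      by rewrite uu /N; ring.
    have h1 : a * u <= `|a| * `|u| by rewrite -normrM ler_norm.
    have h2 : 2 * `|a| <= 1 + N.
      by rewrite /N -aa; have := sqr_ge0 b; have := sqr_ge0 (`|a| - 1); nra.
    have h3 : 2 * (a * u) <= (1 + N) * `|u| by have := normr_ge0 u; nra.
    rewrite /q; nra.
  have dist : (a - u) ^+ 2 + b ^+ 2 <= kp ^+ 2 * ((x - (u + u^-1)) ^+ 2 + y ^+ 2).
    rewrite /kp expr_div_n uu mulrAC ler_pdivlMr ?exprn_gt0//.
    rewrite -(ler_pM2l N0) [leRHS]mulrA id mulrCA ler_wpM2l//.
    by rewrite addr_ge0 ?sqr_ge0.
  have z0 : 0 < eta / (2 * kp) by rewrite divr_gt0// mulr_gt0.
  have small : (a - u) ^+ 2 + b ^+ 2 < eta ^+ 2.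
    apply: (le_lt_trans dist).
    have d1 : (x - (u + u^-1)) ^+ 2 < (eta / (2 * kp)) ^+ 2.
      by rewrite -[ltLHS]real_normK ?num_real// ltr_pXn2r// nnegrE ltW.
    have d2 : y ^+ 2 < (eta / (2 * kp)) ^+ 2.
      by rewrite ltr_pXn2r// nnegrE ltW.
    have e2 : kp ^+ 2 * (eta / (2 * kp)) ^+ 2 = eta ^+ 2 / 4.
      by field; rewrite gt_eqF.
    have kp2 : 0 < kp ^+ 2 by rewrite exprn_gt0.
    have eta20 : 0 < eta ^+ 2 by rewrite exprn_gt0.
    apply: (@lt_trans _ _ (kp ^+ 2 * ((eta / (2 * kp)) ^+ 2 + (eta / (2 * kp)) ^+ 2))).
      by rewrite ltr_pM2l// ltrD.
    by rewrite mulrDr e2; lra.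
  have au : `|a - u| < eta.
    rewrite -(ltr_pXn2r (n := 2)) ?nnegrE ?(ltW eta0)// real_normK ?num_real//.
    by apply: le_lt_trans small; rewrite lerDl sqr_ge0.
  have be : b < eta.
    rewrite -(ltr_pXn2r (n := 2)) ?nnegrE ?(ltW eta0) ?(ltW b0)//.
    by apply: le_lt_trans small; rewrite lerDr sqr_ge0.
  have ar : r < `|a|.
    have := ler_normB a (a - u); rewrite subKr /r.
    by move: au eta2; rewrite /q; lra.
  have Nr : r ^+ 2 < N by rewrite /N -aa; have := sqr_ge0 b; nra.
  have bM : b <= M * y.
    rewrite /M mulrC ler_pdivlMr ?subr_gt0// yE.
    have -> : b - b / N = b * (1 - N^-1) by rewrite mulrBr mulr1.
    by rewrite ler_pM2l// lerB// lef_pV2 ?posrE ?exprn_gt0 ?ltW// (lt_trans _ r1).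
  rewrite {1}xE {1}yE conv//; apply: (@le_trans _ _ (C * b)).
    by apply: H; [exact: lt_le_trans au eta1 | rewrite b0 (lt_le_trans be)].
  apply: (@le_trans _ _ (`|C| * b)); first by rewrite ler_pM2r// ler_norm.
  by rewrite -mulrA ler_wpM2l.
Qed.

End SupportStep.

Section MonotoneConvolution.
Context {R : realType}.
Implicit Types (mu rho sc : probability R R).

Lemma poisson_integral_monotone_conv sc mu rho : is_semicircle sc ->
  is_monotone_conv mu sc rho -> forall a b : R, 0 < b -> 1 < a ^+ 2 + b ^+ 2 ->
  poisson_integral rho (a + a / (a ^+ 2 + b ^+ 2)) (b - b / (a ^+ 2 + b ^+ 2)) =
  poisson_integral mu a b.
Proof.
move=> scP H a b b0 N1.
have y0 : 0 < b - b / (a ^+ 2 + b ^+ 2).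
  by rewrite subr_gt0 ltr_pdivrMr ?(lt_trans _ N1)// ltr_pMr.
have := H (Complex (a + a / (a ^+ 2 + b ^+ 2)) _) y0.
rewrite /rcauchy (cauchy_semicircle sc scP a b b0 N1) invrK => /invr_inj E.
by apply: oppr_inj; rewrite -!Im_cauchy// E.
Qed.

(* The semicircle law is its own monotone convolution with the unit [\d_0]. *)
Lemma poisson_integral_semicircle sc : is_semicircle sc ->
  forall a b : R, 0 < b -> 1 < a ^+ 2 + b ^+ 2 ->
  poisson_integral sc (a + a / (a ^+ 2 + b ^+ 2)) (b - b / (a ^+ 2 + b ^+ 2)) =
  poisson_integral (\d_(0 : R)) a b.
Proof.
move=> scP a b b0 N1.
have y0 : 0 < b - b / (a ^+ 2 + b ^+ 2).
  by rewrite subr_gt0 ltr_pdivrMr ?(lt_trans _ N1)// ltr_pMr.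
apply: oppr_inj; rewrite -Im_cauchy// (cauchy_semicircle sc scP a b b0 N1) complexV /=.
congr (- _); rewrite /poisson_integral /Rintegral integral_dirac//.
  by rewrite diracT mul1e /= /poisson subr0.
apply/measurable_EFinP; apply: continuous_measurable_fun.
exact: continuous_poisson.
Qed.

Lemma msupport_semicircle sc : is_semicircle sc ->
  msupport sc = `[(-2)%R, 2%R]%classic.
Proof.
move=> /poisson_integral_semicircle conv.
have d0 : msupport (\d_(0 : R) : probability R R) 0.
  by move=> e e0; rewrite /= diracE mem_set ?lte01//; exact: ballxx.
apply/seteqP; split=> x /=; rewrite in_itv/= -ler_norml; last first.
  exact: msupport_conv_le2 conv _ _ d0.
case: (leP `|x| 2) => // /joukowski_real [u u1 ->].
move=> /(msupport_conv_gt2 conv u u1) /(_ _ (ltr01 : 0 < 1)).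
rewrite /= diracE memNset ?ltxx// /ball/= subr0.
by apply/negP; rewrite -leNgt ltW.
Qed.

Lemma msupport_monotone_conv sc mu rho (a : R) : is_semicircle sc ->
  is_monotone_conv mu sc rho -> 1 <= a -> msupport mu = `[- a, a]%classic ->
  msupport rho = `[- (a + a^-1), a + a^-1]%classic.
Proof.
move=> scP /(poisson_integral_monotone_conv sc mu rho scP) conv a1 muE.
have a0 : 0 < a by rewrite (lt_le_trans _ a1).
have mu0 : msupport mu 0 by rewrite muE /= in_itv/= oppr_le0 ltW.
have aV : 0 <= a^-1 by rewrite invr_ge0 ltW.
have a2 : 2 <= a + a^-1.
  rewrite -subr_ge0; have -> : a + a^-1 - 2 = (a - 1) ^+ 2 / a.
    by field; rewrite gt_eqF.
  by rewrite divr_ge0 ?sqr_ge0// ltW.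
apply/seteqP; split=> x /=; rewrite in_itv/= -ler_norml.
  case: (leP `|x| 2) => [x2 _|/joukowski_real [u u1 ->]]; first exact: le_trans a2.
  move=> /(msupport_conv_gt2 conv u u1); rewrite muE /= in_itv/= -ler_norml.
  rewrite normr_joukowski le_eqVlt => /predU1P[->//|ua].
  exact/ltW/joukowski_mono/ua/ltW.
move=> xa; case: (leP `|x| 2) => [x2|/joukowski_real [u u1 xu]].
  exact: msupport_conv_le2 conv _ _ mu0 x2.
rewrite xu; apply/(msupport_conv_gt2 conv u u1).
rewrite muE /= in_itv/= -ler_norml leNgt; apply/negP => au.
move: xa; rewrite xu normr_joukowski leNgt => /negP; apply.
exact: joukowski_mono.
Qed.

Lemma eq_msupport mu rho : (forall A : set R, measurable A -> mu A = rho A) ->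
  msupport mu = msupport rho.
Proof.
move=> H; apply/seteqP; split=> x Hx e e0; have := Hx e e0; rewrite H//;
  exact: measurable_ball.
Qed.

End MonotoneConvolution.

Theorem theorem3p9 (R : realType) (sc : probability R R)
  (nu : nat -> probability R R) :
  is_semicircle sc ->
  (forall A : set R, measurable A -> nu 1%N A = sc A) ->
  (forall m : nat, (1 <= m)%N -> is_monotone_conv (nu m) sc (nu m.+1)) ->
  exists a : nat -> R,
    [/\ a 1%N = 2,
        (forall m : nat, (1 <= m)%N -> a m.+1 = a m + (a m)^-1),
        (forall m : nat, (1 <= m)%N -> msupport (nu m) = `[- a m, a m]%classic) &
        (forall m : nat, (2 <= m)%N -> msupport (nu m.-1) `<=` msupport (nu m))].
Proof.
move=> scP nu1 nuS; pose a n : R := iter n.-1 (fun u => u + u^-1) 2.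
have aS m : (1 <= m)%N -> a m.+1 = a m + (a m)^-1 by case: m.
have a_ge1 m : (1 <= m)%N -> 1 <= a m.
  elim: m => [//|[_ _|m IH _]]; first by rewrite /a /= ler1n.
  have am := IH isT; rewrite aS// (le_trans am)// lerDl invr_ge0.
  exact: le_trans ler01 am.
have supp m : (1 <= m)%N -> msupport (nu m) = `[- a m, a m]%classic.
  elim: m => [//|[_ _|m IH _]].
    by rewrite (eq_msupport _ _ nu1) (msupport_semicircle sc scP).
  rewrite aS//; apply: (msupport_monotone_conv _ _ _ _ scP (nuS m.+1 isT)) (IH isT).
  exact: a_ge1.
exists a; split => // -[//|[//|m] _].
rewrite !supp// aS// /= => x /=; rewrite !in_itv/= -!ler_norml => /le_trans; apply.
by rewrite lerDl invr_ge0 (le_trans ler01)// a_ge1.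
Qed.
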